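(* If $H$ is a non-symmetric $4\times 4$ Hadamard matrix in dephased form with non-real entry $\rho$ (i.e. $\rho$ is non-real and is an entry of $2H$), then the trace of $H$ is either $\frac{-1+\rho}{2}$ or $\frac{-1-\rho}{2}$, and the eigenvalues of $H$ are, respectively, \[ \left\{1,-1,\frac{-(1-\rho)\pm\sqrt{1+14\rho+\rho^2}}{4}\right\}\qquad\text{or}\qquad \left\{1,-1,\frac{-(1+\rho)\pm\sqrt{1-14\rho+\rho^2}}{4}\right\}. \]
   Context: An $n\times n$ complex matrix $H$ is called a Hadamard matrix if it is unitary and all its entries have complex modulus $\frac{1}{\sqrt n}$. It is in dephased form if all entries of its first row and first column are equal to $\frac{1}{\sqrt n}$. Entries of $4\times4$ Hadamard matrices are named without the scaling factor $\frac12$, so an entry called $\rho$ is the entry $\frac{\rho}{2}$ of $H$. Non-symmetric means $H^T\ne H$. In the eigenvalue lists, $\pm$ gives two eigenvalues, one for each of the two square roots. *)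

(* Defs.v *)
From HB Require Import structures.
From mathcomp Require Import all_boot all_order all_algebra.
Import Order.TTheory GRing.Theory Num.Theory.
Set Implicit Arguments.
Unset Strict Implicit.
Unset Printing Implicit Defensive.
Local Open Scope ring_scope.

Definition hadamard (C : numClosedFieldType) (n : nat) (H : 'M[C]_n) : Prop :=
  H \is unitarymx /\ forall i j : 'I_n, `|H i j| = 1 / sqrtC n%:R.

Definition dephased (C : numClosedFieldType) (n : nat) (H : 'M[C]_n.+1) : Prop :=
  (forall j, H ord0 j = 1 / sqrtC n.+1%:R) /\
  (forall i, H i ord0 = 1 / sqrtC n.+1%:R).

(* [s] lists the eigenvalues of [A], each repeated according to its algebraic
   multiplicity. *)
Definition eigenvalue_list (F : fieldType) (n : nat) (A : 'M[F]_n)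
    (s : seq F) : Prop :=
  (forall a, eigenvalue A a = (a \in s)) /\
  (forall a, mup a (char_poly A) = count_mem a s).

(* Main.v *)
(* In a dephased 4x4 Hadamard matrix every row of 2H but the first reads
   1, a, b, c with a, b, c unimodular and 1 + a + b + c = 0, which forces
   {a, b, c} = {-1, x, -x} for some x; the same holds for columns. With a
   non-real entry this determines the 3x3 core of 2H up to the order of its rows
   and columns: it is [[s, -1, -s], [-1, 1, -1], [-s, -1, s]], s being plus or
   minus the entry. H is symmetric exactly when the entry 1 of the core lies on
   the diagonal; otherwise a simultaneous permutation of rows and columns leads
   to a single matrix, whose characteristic polynomial is
   (X - 1)(X + 1)(X^2 + (1 - s)/2 X - s). *)
Require Import Defs.
From mathcomp Require Import all_boot all_order all_algebra.
From mathcomp Require Import reals complex perm ring.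
Import Order.TTheory GRing.Theory Num.Theory.
Local Open Scope ring_scope.
Local Open Scope complex_scope.

Set Implicit Arguments.
Unset Strict Implicit.
Unset Printing Implicit Defensive.

(** * Enumerations of the four indices *)

Lemma uniq4_perm_enum (i j k l : 'I_4) :
  uniq [:: i; j; k; l] -> perm_eq [:: i; j; k; l] (enum 'I_4).
Proof.
move=> u; apply: uniq_perm => //; first exact: enum_uniq.
have [||_ //] := @uniq_min_size _ [:: i; j; k; l] (enum 'I_4) u.
- by move=> x _; rewrite mem_enum.
- by rewrite size_enum_ord.
Qed.

Lemma mem_uniq4 (i j k l : 'I_4) (x : 'I_4) :
  uniq [:: i; j; k; l] -> x \in [:: i; j; k; l].
Proof. by move/uniq4_perm_enum/perm_mem ->; rewrite mem_enum. Qed.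

Lemma big_ord4_uniq (V : nmodType) (F : 'I_4 -> V) (i j k l : 'I_4) :
  uniq [:: i; j; k; l] -> \sum_x F x = F i + F j + F k + F l.
Proof.
move=> u; have -> : \sum_x F x = \sum_(x <- enum 'I_4) F x by rewrite big_enum.
rewrite -(perm_big _ (uniq4_perm_enum u)).
by rewrite !big_cons big_nil /= addr0 !addrA.
Qed.

Lemma uniq4_completion (j : 'I_4) : j != ord0 ->
  exists k l : 'I_4, uniq [:: ord0; j; k; l].
Proof.
case: j => [[|[|[|[|//]]]] Hj] // _.
- by exists (inord 2), (inord 3); rewrite /= !inE -!val_eqE /= !inordK.
- by exists (inord 1), (inord 3); rewrite /= !inE -!val_eqE /= !inordK.
- by exists (inord 1), (inord 2); rewrite /= !inE -!val_eqE /= !inordK.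
Qed.

(** * Determinants of order three and four *)

Lemma det_reindex (S : comPzRingType) (n : nat) (A : 'M[S]_n)
    (s : {perm 'I_n}) :
  \det (\matrix_(i, j) A (s i) (s j)) = \det A.
Proof.
have -> : \matrix_(i, j) A (s i) (s j) = row_perm s (col_perm s A).
  by apply/matrixP=> i j; rewrite !mxE.
rewrite row_permE col_permE !det_mulmx !det_perm odd_permV mulrCA.
by rewrite -expr2 sqrr_sign mulr1.
Qed.

Lemma det_mx33 (S : comNzRingType) (A : 'M[S]_3) :
  let a m n := A (inord m) (inord n) in
  let m2 p q := a 1%N p * a 2%N q - a 1%N q * a 2%N p in
  \det A = a 0%N 0%N * m2 1%N 2%N - a 0%N 1%N * m2 0%N 2%N
           + a 0%N 2%N * m2 0%N 1%N.
Proof.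
move=> a m2.
have aE i j : A i j = a i j by rewrite /a !inord_val.
rewrite (expand_det_row _ ord0) !big_ord_recl big_ord0 /cofactor.
rewrite !(expand_det_row _ ord0) !big_ord_recl !big_ord0 /cofactor !det_mx11.
rewrite !mxE !aE /m2 /= /bump /=; ring.
Qed.

(** Moving rows and columns by the same permutation keeps the determinant, so Laplace expansion
    works along any ordering of the indices. This avoids a case analysis on where the core sits. *)
Lemma det_mx44 (S : comNzRingType) (A : 'M[S]_4) (i j k l : 'I_4) :
  uniq [:: i; j; k; l] ->
  let m2 a b := A k a * A l b - A k b * A l a in
  let m3 a b c := A j a * m2 b c - A j b * m2 a c + A j c * m2 a b in
  \det A = A i i * m3 j k l - A i j * m3 i k l
           + A i k * m3 i j l - A i l * m3 i j k.
Proof.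
move=> u m2 m3.
have inj : injective (tnth [tuple i; j; k; l]) by apply/tuple_uniqP.
pose a x y := A (nth i [:: i; j; k; l] x) (nth i [:: i; j; k; l] y).
have <- : \det (\matrix_(x < 4, y < 4) a x y) = \det A.
  rewrite -(det_reindex A (perm inj)); congr (\det _).
  by apply/matrixP => x y; rewrite !mxE !permE !(tnth_nth i).
rewrite (expand_det_row _ ord0) !big_ord_recl big_ord0 /cofactor !det_mx33.
rewrite !mxE /= /bump !inordK //=.
rewrite /m3 /m2 /a /=; ring.
Qed.

(** Solves a vanishing row or column sum [c] for one entry; what remains is an identity for
    [ring]. *)
Lemma eq_of_subr0 (V : zmodType) (a b c : V) : c = 0 -> a - b = c -> a = b.
Proof. by move=> -> /subr0_eq. Qed.

Lemma unimodular_sum4_eq0 (C : numClosedFieldType) (a b c : C) :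
  `|a| = 1 -> `|b| = 1 -> `|c| = 1 -> 1 + a + b + c = 0 ->
  (1 + a) * (1 + b) * (1 + c) = 0.
Proof.
have unit (x : C) : `|x| = 1 -> x * x^* = 1.
  by move=> x1; rewrite -normCK x1 expr1n.
move=> /unit ua /unit ub /unit uc s0.
have s0' : 1 + a^* + b^* + c^* = 0.
  by rewrite -[RHS](rmorph0 Num.conj) -s0 !rmorphD rmorph1.
(* For unimodular [a], [b], [c], the symmetric function [ab + bc + ca] is
   [abc] times the conjugate of [a + b + c]. *)
have -> : (1 + a) * (1 + b) * (1 + c) =
    1 + a + b + c + a * b * c * (1 + a^* + b^* + c^*) by ring: ua ub uc.
by rewrite s0 s0' mulr0 addr0.
Qed.

(** Rows and columns are listed independently: the pattern is fixed, while the place [(i', k)] of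
    its entry [1] stays free. *)
Definition has_core (C : numClosedFieldType) (H : 'M[C]_4) (s : C)
    (i i' i'' j k l : 'I_4) : Prop :=
  [/\ [/\ 2 * H i j = s, 2 * H i k = -1 & 2 * H i l = - s],
      [/\ 2 * H i' j = -1, 2 * H i' k = 1 & 2 * H i' l = -1]
    & [/\ 2 * H i'' j = - s, 2 * H i'' k = -1 & 2 * H i'' l = s]].

(** * Rows and columns of dephased Hadamard matrices of order four *)

Lemma sqrtC4 (C : numClosedFieldType) : sqrtC 4%:R = 2 :> C.
Proof. by rewrite -[RHS]sqrCK ?ler0n // -natrX. Qed.

Lemma hadamard_trmx (C : numClosedFieldType) (n : nat) (H : 'M[C]_n) :
  hadamard H -> hadamard H^T.
Proof.
by case=> uH nH; split=> [|i j]; rewrite ?trmx_unitary // mxE nH.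
Qed.

Lemma dephased_trmx (C : numClosedFieldType) (n : nat) (H : 'M[C]_n.+1) :
  dephased H -> dephased H^T.
Proof. by case=> r c; split=> i; rewrite mxE. Qed.

Lemma dephased4_border (C : numClosedFieldType) (H : 'M[C]_4) : dephased H ->
  forall i, 2 * H ord0 i = 1 /\ 2 * H i ord0 = 1.
Proof.
by case=> r c i; rewrite r c sqrtC4 mul1r divff // pnatr_eq0.
Qed.

Lemma hadamard4_norm (C : numClosedFieldType) (H : 'M[C]_4) (i j : 'I_4) :
  hadamard H -> `|2 * H i j| = 1.
Proof.
by case=> _ nH; rewrite normrM nH sqrtC4 normr_nat mul1r divff // pnatr_eq0.
Qed.

Lemma hadamard4_dot (C : numClosedFieldType) (H : 'M[C]_4) (i i' : 'I_4) :
  hadamard H -> i != i' -> \sum_x (2 * H i x) * (2 * H i' x)^* = 0.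
Proof.
case=> /unitarymxP/matrixP/(_ i i') + _ ni; rewrite !mxE (negbTE ni) => e.
rewrite -[RHS](mulr0 4) -[in RHS](e : _ = 0) mulr_sumr; apply: eq_bigr => x _.
by rewrite !mxE rmorphM rmorph_nat; ring.
Qed.

(** Orthogonality to the constant first row makes the row sum vanish; unimodularity then forces an
    entry [-1]. *)
Lemma dephased4_row (C : numClosedFieldType) (H : 'M[C]_4) (i j k l : 'I_4) :
  hadamard H -> dephased H -> i != ord0 -> uniq [:: ord0; j; k; l] ->
  1 + 2 * H i j + 2 * H i k + 2 * H i l = 0 /\
  [\/ 2 * H i j = -1, 2 * H i k = -1 | 2 * H i l = -1].
Proof.
move=> hH dH ni u.
have s0 : 1 + 2 * H i j + 2 * H i k + 2 * H i l = 0.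
  rewrite -[RHS](hadamard4_dot hH ni) (big_ord4_uniq _ u).
  rewrite !(proj1 (dephased4_border dH _)) rmorph1 !mulr1.
  by rewrite (proj2 (dephased4_border dH _)).
split=> //.
have /eqP := unimodular_sum4_eq0 (hadamard4_norm i j hH)
  (hadamard4_norm i k hH) (hadamard4_norm i l hH) s0.
rewrite !mulf_eq0 ![1 + 2 * _]addrC !addr_eq0.
by move=> /orP[/orP[]|] /eqP e; [constructor 1|constructor 2|constructor 3].
Qed.

Lemma dephased4_row_nonreal (C : numClosedFieldType) (H : 'M[C]_4)
    (i j : 'I_4) : hadamard H -> dephased H -> i != ord0 -> j != ord0 ->
  2 * H i j \isn't Num.real ->
  exists k l, [/\ uniq [:: ord0; j; k; l], 2 * H i k = -1
                & 2 * H i l = - (2 * H i j)].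
Proof.
move=> hH dH ni nj nr; have [k [l u]] := uniq4_completion nj.
have u' : uniq [:: ord0; j; l; k].
  rewrite -(perm_uniq (s1 := [:: ord0; j; k; l])) //.
  by rewrite !perm_cons (perm_catC [:: k]).
have [s0 [e|e|e]] := dephased4_row hH dH ni u.
- by move: nr; rewrite e realN real1.
- exists k, l; split=> //; apply: (eq_of_subr0 s0); rewrite e; ring.
- exists l, k; split=> //; apply: (eq_of_subr0 s0); rewrite e; ring.
Qed.

(** The nonreal entry settles row [i] and, by transposition, column [j]. Row [i''] has [- rho] in
    column [j], so its [-1] lies in column [k] or [l]; the first case gives the core through zero
    sums, the second is impossible. *)
Lemma hadamard4_has_core (C : numClosedFieldType) (H : 'M[C]_4) (i j : 'I_4) :
  hadamard H -> dephased H -> i != ord0 -> j != ord0 ->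
  2 * H i j \isn't Num.real ->
  exists i' i'' k l, [/\ uniq [:: ord0; i; i'; i''], uniq [:: ord0; j; k; l]
    & has_core H (2 * H i j) i i' i'' j k l].
Proof.
set rho := 2 * H i j => hH dH ni nj nr.
have hT := hadamard_trmx hH; have dT := dephased_trmx dH.
have [k [l [uc eik eil]]] := dephased4_row_nonreal hH dH ni nj nr.
have [|i' [i'' [ur]]] := dephased4_row_nonreal hT dT nj ni.
  by rewrite mxE.
rewrite !mxE -/rho => ei'j ei''j.
have [ni' ni'' nii' nk] :
    [/\ i' != ord0, i'' != ord0, i != i' & k != ord0].
  move: ur uc; rewrite /= !inE !negb_or.
  move=> /andP[/and3P[_ ? ?] /andP[/andP[? _] _]] /andP[/and3P[_ ? _] _].
  by split; rewrite // eq_sym.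
have nr1 : - rho != -1.
  by rewrite eqr_opp; apply: contraNneq nr => ->; rewrite real1.
have [r's0 _] := dephased4_row hH dH ni' uc.
have [r''s0 r''] := dephased4_row hH dH ni'' uc.
have [cks0 _] := dephased4_row hT dT nk ur.
rewrite !mxE in cks0.
exists i', i'', k, l; split=> //.
case: r'' => [e|e|e].
- by move: nr1; rewrite -ei''j e eqxx.
- have ei'k : 2 * H i' k = 1 by apply: (eq_of_subr0 cks0); rewrite eik e; ring.
  have ei''l : 2 * H i'' l = rho.
    by apply: (eq_of_subr0 r''s0); rewrite ei''j e; ring.
  have ei'l : 2 * H i' l = -1.
    by apply: (eq_of_subr0 r's0); rewrite ei'j ei'k; ring.
  by split; split.
- (* Here the core is a Latin square on [rho], [-1], [- rho], and the
     orthogonality of its rows forces [rho] to be real. *)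
  exfalso.
  have ei''k : 2 * H i'' k = rho.
    by apply: (eq_of_subr0 r''s0); rewrite e ei''j; ring.
  have ei'k : 2 * H i' k = - rho.
    by apply: (eq_of_subr0 cks0); rewrite eik ei''k; ring.
  have ei'l : 2 * H i' l = rho.
    by apply: (eq_of_subr0 r's0); rewrite ei'j ei'k; ring.
  have := hadamard4_dot hH nii'.
  rewrite (big_ord4_uniq _ uc) !(proj2 (dephased4_border dH _)).
  rewrite -/rho ei'j eik ei'k eil ei'l rmorphN rmorph1 !rmorphN.
  rewrite !mulrN !mulNr !mulr1 !mul1r opprK.
  rewrite -normCK (hadamard4_norm _ _ hH) expr1n => e0.
  move: nr; rewrite CrealE -/rho -subr_eq0 -e0; apply/negP/negPn/eqP; ring.
Qed.

(** * Symmetric and nonsymmetric positions of the core *)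

Lemma has_core_swap_rows (C : numClosedFieldType) (H : 'M[C]_4) (s : C)
    (i i' i'' j k l : 'I_4) :
  has_core H s i i' i'' j k l -> has_core H (- s) i'' i' i j k l.
Proof. by case=> -[? ? ?] [? ? ?] [? ? ?]; split; split; rewrite // opprK. Qed.

Lemma has_core_swap_cols (C : numClosedFieldType) (H : 'M[C]_4) (s : C)
    (i i' i'' j k l : 'I_4) :
  has_core H s i i' i'' j k l -> has_core H (- s) i i' i'' l k j.
Proof. by case=> -[? ? ?] [? ? ?] [? ? ?]; split; split; rewrite // opprK. Qed.

(** The pattern is symmetric about both of its diagonals, so with its centre at [(i', i')] either
    matching of [i], [i''] with [j], [l] gives a symmetric matrix. *)
Lemma has_core_sym (C : numClosedFieldType) (H : 'M[C]_4) (s : C)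
    (i i' i'' j l : 'I_4) :
  dephased H -> uniq [:: ord0; i; i'; i''] -> uniq [:: ord0; j; i'; l] ->
  has_core H s i i' i'' j i' l -> H^T = H.
Proof.
move=> dH ur uc [[e1 e2 e3] [e4 e5 e6] [e7 e8 e9]].
have [b0 b1] : (forall x, 2 * H ord0 x = 1) /\ (forall x, 2 * H x ord0 = 1).
  by split=> x; have [] := dephased4_border dH x.
have [[ij i''l]|[il i''j]] : (i = j /\ i'' = l) \/ (i = l /\ i'' = j).
  have mi := mem_uniq4 i uc; have mi'' := mem_uniq4 i'' uc; move: mi mi'' ur.
  rewrite !inE => /or4P[]/eqP-> /or4P[]/eqP->;
    by rewrite /= ?inE ?eqxx ?orbT ?andbF //; auto.
all: subst j l; apply/matrixP=> x y; rewrite mxE; apply: (@mulfI _ 2).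
1,3: by rewrite pnatr_eq0.
all: have := mem_uniq4 x ur; have := mem_uniq4 y ur; rewrite !inE.
all: by move=> /or4P[]/eqP-> /or4P[]/eqP->;
  rewrite ?b0 ?b1 ?(e1, e2, e3, e4, e5, e6, e7, e8, e9).
Qed.

(* Swapping rows or columns of the core only affects the sign of [s]; this
   brings every nonsymmetric core to a single pattern. *)
Lemma has_core_nonsym (C : numClosedFieldType) (H : 'M[C]_4) (s : C)
    (i i' i'' j k l : 'I_4) :
  dephased H -> H^T <> H ->
  uniq [:: ord0; i; i'; i''] -> uniq [:: ord0; j; k; l] ->
  has_core H s i i' i'' j k l ->
  exists p q r t, [/\ uniq [:: ord0; p; q; r], t = s \/ t = - s
                    & has_core H t q p r p q r].
Proof.
move=> dH nonsym ur uc core.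
have ki' : k != i'.
  apply/eqP=> ki'; apply: nonsym; move: uc core; rewrite ki'.
  exact: has_core_sym.
(* As [k] differs from [i'], it is one of the outer rows; a row swap makes it [i]. Likewise [i'] is
   an outer column, made [j] by a column swap. *)
wlog ki : i i'' s ur core / k = i.
  move=> IH; have : (k == i) || (k == i'').
    have := mem_uniq4 k ur; move: uc; rewrite /= !inE (negbTE ki') /=.
    by rewrite ![ord0 == _]eq_sym; case: (k == ord0); rewrite ?orbT.
  case/orP=> /eqP ki; first exact: IH ur core ki.
  have ur' : uniq (ord0 :: rev [:: i; i'; i'']).
    by rewrite cons_uniq mem_rev rev_uniq -cons_uniq.
  have [p [q [r [t [u et c]]]]] := IH _ _ _ ur' (has_core_swap_rows core) ki.
  by exists p, q, r, t; split=> //; case: et => ->; rewrite ?opprK; auto.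
wlog ji' : j l s uc core / j = i'.
  move=> IH; have : (i' == j) || (i' == l).
    have := mem_uniq4 i' uc; move: ur.
    rewrite /= !inE (eq_sym i' k) (negbTE ki') /=.
    by rewrite ![ord0 == _]eq_sym; case: (i' == ord0); rewrite ?orbT.
  case/orP=> /eqP i'j; first exact: IH uc core (esym i'j).
  have uc' : uniq (ord0 :: rev [:: j; k; l]).
    by rewrite cons_uniq mem_rev rev_uniq -cons_uniq.
  have [p [q [r [t [u et c]]]]] :=
    IH _ _ _ uc' (has_core_swap_cols core) (esym i'j).
  by exists p, q, r, t; split=> //; case: et => ->; rewrite ?opprK; auto.
have i''l : i'' = l.
  move: (mem_uniq4 i'' uc) ur; rewrite ki ji' !inE => /or4P[]/eqP-> //;
    by rewrite /= ?inE ?eqxx ?orbT ?andbF.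
by exists j, k, l, s; subst; split=> //; left.
Qed.

(** * Characteristic polynomial and eigenvalues *)

(** In the order [ord0], [p], [q], [r], the rows of [2 * H] are [(1, 1, 1, 1)], [(1, -1, 1, -1)],
    [(1, s, -1, -s)] and [(1, -s, -1, s)]. *)
Lemma has_core_char_poly (C : numClosedFieldType) (H : 'M[C]_4) (s : C)
    (p q r : 'I_4) :
  dephased H -> uniq [:: ord0; p; q; r] -> has_core H s q p r p q r ->
  \tr H = (- 1 + s) / 2 /\
  char_poly H =
    ('X - 1%:P) * ('X - (-1)%:P) * ('X^2 + ((1 - s) / 2)%:P * 'X - s%:P).
Proof.
move=> dH u [[eqp eqq eqr] [epp epq epr] [erp erq err]].
have half x y : H x y = (2 * H x y) / 2.
  by rewrite mulrAC divff ?mul1r // pnatr_eq0.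
have [b0 b1] : (forall x, H ord0 x = 1 / 2) /\ (forall x, H x ord0 = 1 / 2).
  by split=> x; rewrite half;
    have [h0 h1] := dephased4_border dH x; rewrite ?h0 ?h1.
have {}eqp : H q p = s / 2 by rewrite half eqp.
have {}eqq : H q q = -1 / 2 by rewrite half eqq.
have {}eqr : H q r = - s / 2 by rewrite half eqr.
have {}epp : H p p = -1 / 2 by rewrite half epp.
have {}epq : H p q = 1 / 2 by rewrite half epq.
have {}epr : H p r = -1 / 2 by rewrite half epr.
have {}erp : H r p = - s / 2 by rewrite half erp.
have {}erq : H r q = -1 / 2 by rewrite half erq.
have {}err : H r r = s / 2 by rewrite half err.
split; first by rewrite /mxtrace (big_ord4_uniq _ u) b0 epp eqq err; field.
have nd x y : x != y -> char_poly_mx H x y = - (H x y)%:P.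
  by move=> /negbTE xy; rewrite !mxE xy mulr0n add0r.
have d x : char_poly_mx H x x = 'X - (H x x)%:P by rewrite !mxE eqxx mulr1n.
rewrite /char_poly (det_mx44 _ u) !d.
move: u; rewrite /= !inE !negb_or.
move=> /andP[/and3P[n0p n0q n0r] /andP[/andP[npq npr] /andP[nqr _]]].
rewrite !nd // 1?eq_sym //.
rewrite !b0 !b1 epp epq epr eqp eqq eqr erp erq err.
(* Polynomials do not form a field, so one half enters as a constant [h] with [2 * h = 1]. *)
have h1 : 2 * (2^-1)%:P = 1 :> {poly C}.
  by rewrite -[2](rmorph_nat polyC) -polyCM divff ?pnatr_eq0.
rewrite !(polyCM, polyCN, polyCB, polyC1).
set h := (2^-1)%:P in h1 *.
(* Homogeneous of degree 4 in ['X] and [h], like the left-hand side. *)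
transitivity (('X - 2 * h) * ('X + 2 * h) *
  ('X^2 + (1 - s%:P) * h * 'X - s%:P * (2 * h) * (2 * h))).
  ring.
by rewrite h1; ring.
Qed.

Lemma char_poly_eigenvalue_list (F : fieldType) (n : nat) (A : 'M[F]_n)
    (t : seq F) :
  char_poly A = \prod_(a <- t) ('X - a%:P) -> eigenvalue_list A t.
Proof.
move=> e; split=> a.
- by rewrite eigenvalue_root_char e root_prod_XsubC.
- by rewrite e mu_prod_XsubC.
Qed.

Lemma has_core_eigenvalues (C : numClosedFieldType) (H : 'M[C]_4) (s : C)
    (p q r : 'I_4) :
  dephased H -> uniq [:: ord0; p; q; r] -> has_core H s q p r p q r ->
  \tr H = (- 1 + s) / 2 /\
  eigenvalue_list H
    [:: 1; - 1;
        (- (1 - s) + sqrtC (1 + 14 * s + s ^+ 2)) / 4;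
        (- (1 - s) - sqrtC (1 + 14 * s + s ^+ 2)) / 4].
Proof.
move=> dH u core; have [trH chH] := has_core_char_poly dH u core.
split=> //; apply: char_poly_eigenvalue_list.
rewrite chH !big_cons big_nil mulr1 -mulrA; congr (_ * (_ * _)).
set w := sqrtC _; have ws : w ^+ 2 = 1 + 14 * s + s ^+ 2 by rewrite sqrtCK.
set a := _ / 4; set b := _ / 4.
(* Vieta for the quadratic factor: the product is [- s] because [(1 - s)^2 - w^2 = - 16 s]. *)
have -> : (1 - s) / 2 = - (a + b) by rewrite /a /b; field.
have -> : s = - (a * b) by rewrite /a /b; field: ws.
clearbody a b; rewrite !(polyCN, polyCD, polyCM); ring.
Qed.

Theorem corollary2 (R : realType) (H : 'M[R[i]]_4) (rho : R[i])
    (hadamardH : hadamard H) (dephasedH : dephased H)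
    (nonsymH : H^T <> H)
    (nonreal_rho : rho \isn't Num.real)
    (entry_rho : exists i j : 'I_4, H i j = rho / 2) :
  (\tr H = (- 1 + rho) / 2 /\
   eigenvalue_list H
     [:: 1; - 1;
         (- (1 - rho) + sqrtC (1 + 14 * rho + rho ^+ 2)) / 4;
         (- (1 - rho) - sqrtC (1 + 14 * rho + rho ^+ 2)) / 4]) \/
  (\tr H = (- 1 - rho) / 2 /\
   eigenvalue_list H
     [:: 1; - 1;
         (- (1 + rho) + sqrtC (1 - 14 * rho + rho ^+ 2)) / 4;
         (- (1 + rho) - sqrtC (1 - 14 * rho + rho ^+ 2)) / 4]).
Proof.
have [i [j eij]] := entry_rho.
have e : 2 * H i j = rho by rewrite eij mulrC divfK // pnatr_eq0.
(* The border of [2 * H] consists of ones, so the nonreal entry lies in the core. *)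
have ni : i != ord0.
  apply: contraNneq nonreal_rho => i0.
  by rewrite -e i0 (proj1 (dephased4_border dephasedH _)) real1.
have nj : j != ord0.
  apply: contraNneq nonreal_rho => j0.
  by rewrite -e j0 (proj2 (dephased4_border dephasedH _)) real1.
rewrite -e in nonreal_rho.
have [i' [i'' [k [l [ur uc]]]]] :=
  hadamard4_has_core hadamardH dephasedH ni nj nonreal_rho.
rewrite e => core.
have [p [q [r [s [u es core']]]]] :=
  has_core_nonsym dephasedH nonsymH ur uc core.
have := has_core_eigenvalues dephasedH u core'.
(* The sign of [s] relative to [rho] selects the alternative. *)
case: es => -> ev; first by left.
by right; move: ev; rewrite opprK mulrN sqrrN.
Qed.
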